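(* Let $\lambda$ be a nonzero real number. For every $n \in \mathbb{N}$, \[ H_{n,\lambda}= \frac{1}{n!} \sum_{j=1}^n\binom{n}{j}d_{n-j,\lambda} \sum_{k=1}^j k! \binom{j}{k} \left(H_{k,\lambda}-H_{k-1,\lambda}\right) (1)_{j-k,\lambda}. \]
   Context: For real $x$ and integer $k\ge0$, $\binom{x}{k}=\frac{x(x-1)\cdots(x-k+1)}{k!}$. Degenerate falling factorials: $(x)_{0,\lambda}=1$, $(x)_{n,\lambda}=x(x-\lambda)\cdots(x-(n-1)\lambda)$ for $n\ge1$. The degenerate exponential is $e_\lambda^x(t)=\sum_{k\ge0}(x)_{k,\lambda}\frac{t^k}{k!}=(1+\lambda t)^{x/\lambda}$, with $e_\lambda(t)=e_\lambda^1(t)$. The degenerate derangement numbers $d_{n,\lambda}$ are defined by $\frac{1}{1-t}e_\lambda^{-1}(t)=\sum_{n=0}^\infty d_{n,\lambda}\frac{t^n}{n!}$. The degenerate harmonic numbers are $H_{0,\lambda}=0$ and $H_{n,\lambda}=\sum_{k=1}^{n}\binom{\lambda-1}{k-1}\frac{(-1)^{k-1}}{k}$ for $n\in\mathbb{N}$. *)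

(* Defs.v *)
From Stdlib Require Import Reals Factorial Lra Lia.
From Coquelicot Require Import Coquelicot.
Open Scope R_scope.

Fixpoint deg_ffact (lambda x : R) (n : nat) : R :=
  match n with
  | O => 1
  | S m => deg_ffact lambda x m * (x - INR m * lambda)
  end.

Definition gbinom (x : R) (k : nat) : R := deg_ffact 1 x k / INR (fact k).

(* The value is meaningful inside the disc of convergence, which always
   contains a neighbourhood of 0, see [CV_radius_deg_exp]. *)
Definition deg_exp (lambda x t : R) : R :=
  PSeries (fun k => deg_ffact lambda x k / INR (fact k)) t.

(* [d] is the sequence with exponential generating function
   [deg_exp lambda (-1) t / (1 - t)]. The identity is required for [t] near 0,
   which determines [d]: see [deg_derangement_exists] and
   [deg_derangement_unique]. *)
Definition is_deg_derangement (lambda : R) (d : nat -> R) : Prop :=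
  locally 0 (fun t : R =>
    is_pseries (fun n => d n / INR (fact n)) t
      (/ (1 - t) * deg_exp lambda (-1) t)).

(* [sum_n_m a 1 0 = 0], so [deg_harmonic lambda 0 = 0]. *)
Definition deg_harmonic (lambda : R) (n : nat) : R :=
  sum_n_m (fun k => gbinom (lambda - 1) (k - 1) * ((-1) ^ (k - 1) / INR k)) 1 n.

Lemma deg_ffact_bound (lambda x : R) (n : nat) :
  Rabs (deg_ffact lambda x n / INR (fact n)) <= (Rabs x + Rabs lambda) ^ n.
Proof.
induction n as [|n IH].
- simpl. replace (1 / 1) with 1 by field. rewrite Rabs_R1. lra.
- assert (Hn : 0 < INR (S n)) by (apply lt_0_INR; lia).
  assert (Hf : 0 < INR (fact n)) by apply INR_fact_lt_0.
  replace (deg_ffact lambda x (S n) / INR (fact (S n)))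
    with ((deg_ffact lambda x n / INR (fact n)) * ((x - INR n * lambda) / INR (S n))).
  2:{ simpl deg_ffact. rewrite fact_simpl, mult_INR. field. lra. }
  rewrite Rabs_mult, <- tech_pow_Rmult, Rmult_comm.
  apply Rmult_le_compat; try apply Rabs_pos; auto.
  unfold Rdiv. rewrite Rabs_mult, (Rabs_pos_eq (/ _)).
  2:{ left. now apply Rinv_0_lt_compat. }
  apply Rmult_le_reg_r with (INR (S n)); auto.
  rewrite Rmult_assoc, Rinv_l, Rmult_1_r by lra.
  unfold Rminus. eapply Rle_trans; [apply Rabs_triang|].
  rewrite Rabs_Ropp, Rabs_mult, (Rabs_pos_eq (INR n)) by apply pos_INR.
  rewrite S_INR.
  pose proof (pos_INR n). pose proof (Rabs_pos x). pose proof (Rabs_pos lambda).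
  nra.
Qed.

Lemma CV_radius_deg_exp (lambda x : R) :
  Rbar_lt 0 (CV_radius (fun k => deg_ffact lambda x k / INR (fact k))).
Proof.
set (M := Rabs x + Rabs lambda + 1).
assert (HM : 0 < M).
{ unfold M. pose proof (Rabs_pos x). pose proof (Rabs_pos lambda). lra. }
apply Rbar_lt_le_trans with (Finite (/ M)).
- now apply Rinv_0_lt_compat.
- apply CV_radius_bounded. exists 1. intro n.
  rewrite Rabs_mult, <- RPow_abs, (Rabs_pos_eq (/ M)).
  2:{ left. now apply Rinv_0_lt_compat. }
  rewrite pow_inv.
  apply Rmult_le_reg_r with (M ^ n); [now apply pow_lt|].
  rewrite Rmult_assoc, Rinv_l, Rmult_1_r, Rmult_1_l by (apply pow_nonzero; lra).
  eapply Rle_trans; [apply deg_ffact_bound|].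
  apply pow_incr. split; [|unfold M; lra].
  pose proof (Rabs_pos x). pose proof (Rabs_pos lambda). lra.
Qed.

Lemma deg_derangement_exists (lambda : R) :
  exists d, is_deg_derangement lambda d.
Proof.
set (a := fun k => deg_ffact lambda (-1) k / INR (fact k)).
exists (fun n => INR (fact n) * PS_mult (fun _ => 1) a n).
assert (Hloc : locally 0 (fun t : R => Rbar_lt (Rabs t) (CV_radius a))).
{ pose proof (CV_radius_deg_exp lambda (-1)) as H. fold a in H.
  destruct (CV_radius a) as [r| |]; simpl in H; try easy.
  - exists (mkposreal r H). intros t Ht. unfold ball in Ht; simpl in Ht.
    unfold AbsRing_ball, abs, minus, plus, opp in Ht; simpl in Ht.
    rewrite Ropp_0, Rplus_0_r in Ht. exact Ht.
  - exists (mkposreal 1 Rlt_0_1). intros t _. exact I. }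
assert (H1 : locally 0 (fun t : R => Rabs t < 1)).
{ exists (mkposreal 1 Rlt_0_1). intros t Ht. unfold ball in Ht; simpl in Ht.
  unfold AbsRing_ball, abs, minus, plus, opp in Ht; simpl in Ht.
  rewrite Ropp_0, Rplus_0_r in Ht. exact Ht. }
unfold is_deg_derangement.
generalize (filter_and _ _ Hloc H1). apply filter_imp. intros t [Ha Ht].
apply is_pseries_ext with (PS_mult (fun _ => 1) a).
{ intro n. simpl. rewrite Rmult_comm. unfold Rdiv.
  rewrite Rmult_assoc, Rinv_r, Rmult_1_r; [easy|apply INR_fact_neq_0]. }
assert (Hg : Rbar_lt (Rabs t) (CV_radius (fun _ => 1))).
{ rewrite (CV_radius_finite_DAlembert (fun _ => 1) 1).
  - simpl. now rewrite Rinv_1.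
  - intros _. lra.
  - lra.
  - apply is_lim_seq_ext with (fun _ => 1).
    + intros _. replace (1 / 1) with 1 by field. now rewrite Rabs_R1.
    + apply is_lim_seq_const. }
apply is_pseries_mult; auto.
- apply is_pseries_R. apply is_series_ext with (fun n => t ^ n).
  + intro n. simpl. now rewrite Rmult_1_l.
  + now apply is_series_geom.
- apply PSeries_correct. now apply CV_radius_inside.
Qed.

Lemma deg_derangement_unique (lambda : R) (d d' : nat -> R) :
  is_deg_derangement lambda d -> is_deg_derangement lambda d' ->
  forall n, d n = d' n.
Proof.
intros H H' n.
assert (Hr : forall c, is_deg_derangement lambda c ->
  Rbar_lt 0 (CV_radius (fun n => c n / INR (fact n)))).
{ intros c [e He].
  assert (Hb : ball 0 e (e / 2)).
  { unfold ball; simpl. unfold AbsRing_ball, abs, minus, plus, opp; simpl.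
    pose proof (cond_pos e). rewrite Ropp_0, Rplus_0_r, Rabs_pos_eq; lra. }
  apply Rbar_lt_le_trans with (Finite (Rabs (e / 2))).
  - pose proof (cond_pos e). simpl. rewrite Rabs_pos_eq; lra.
  - apply Rbar_not_lt_le. intro Hlt. apply CV_disk_outside in Hlt.
    apply Hlt. apply is_lim_seq_ext with (fun k => c k / INR (fact k) * (e / 2) ^ k).
    + easy.
    + apply ex_series_lim_0. eexists.
      apply is_pseries_R. apply (He _ Hb). }
assert (Heq : d n / INR (fact n) = d' n / INR (fact n)).
{ apply (PSeries_ext_recip (fun n => d n / INR (fact n))
           (fun n => d' n / INR (fact n))); auto.
  generalize (filter_and _ _ H H'). apply filter_imp. intros t [Ht Ht'].
  now rewrite (is_pseries_unique _ _ _ Ht), (is_pseries_unique _ _ _ Ht'). }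
pose proof (INR_fact_neq_0 n).
apply Rmult_eq_reg_r with (/ INR (fact n)); auto.
now apply Rinv_neq_0_compat.
Qed.

(* Main.v *)
(* With [E] and [A] the coefficient sequences of [deg_exp lambda 1] and
   [deg_exp lambda (-1)], and [h k = H k - H (k - 1)], the right-hand side is the
   [n]-th coefficient of the product of [h], [E] and [A / (1 - t)]. Since
   [E * A = 1] (Vandermonde), this is the [n]-th coefficient of [h / (1 - t)],
   a partial sum of [h], which telescopes to [H n]. *)
Require Import Defs.
From Stdlib Require Import Reals Factorial Lra Lia.
From Coquelicot Require Import Coquelicot.
Open Scope R_scope.

Lemma PS_mult_succ (a b : nat -> R) (n : nat) :
  PS_mult a b (S n) = a 0%nat * b (S n) + PS_mult (fun k => a (S k)) b n.
Proof.
unfold PS_mult. rewrite decomp_sum by lia. reflexivity.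
Qed.

Lemma PS_mult_ext (a a' b b' : nat -> R) (n : nat) :
  (forall k, a k = a' k) -> (forall k, b k = b' k) ->
  PS_mult a b n = PS_mult a' b' n.
Proof.
intros Ha Hb. apply sum_eq. intros k _. now rewrite Ha, Hb.
Qed.

Lemma PS_mult_comm (a b : nat -> R) (n : nat) : PS_mult a b n = PS_mult b a n.
Proof.
unfold PS_mult. rewrite <- sum_f_R0_skip. apply sum_eq. intros k Hk.
replace (n - (n - k))%nat with k by lia. apply Rmult_comm.
Qed.

(** The shape [c * a k + a' k] is that of the right-hand sides of [PS_mult_succ] and
    [deg_ffact_fact_succ]. *)
Lemma PS_mult_linear_l (c : R) (a a' b : nat -> R) (n : nat) :
  PS_mult (fun k => c * a k + a' k) b n = c * PS_mult a b n + PS_mult a' b n.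
Proof.
unfold PS_mult. rewrite scal_sum, <- plus_sum. apply sum_eq. intros k _. ring.
Qed.

(** Splitting off the constant term of [a] leaves its shift [fun k => a (S k)], so the induction on
    [n] must hold for every [a]. *)
Lemma PS_mult_assoc (a b c : nat -> R) (n : nat) :
  PS_mult (PS_mult a b) c n = PS_mult a (PS_mult b c) n.
Proof.
revert a. induction n as [|n IH]; intro a; [unfold PS_mult; simpl; ring|].
rewrite !PS_mult_succ.
rewrite (PS_mult_ext (fun k => PS_mult a b (S k))
  (fun k => a 0%nat * b (S k) + PS_mult (fun i => a (S i)) b k) c c)
  by (reflexivity || apply PS_mult_succ).
rewrite (PS_mult_linear_l _ (fun k => b (S k))), IH.
unfold PS_mult at 1; simpl sum_f_R0. ring.
Qed.

Lemma PS_mult_delta_l (a b : nat -> R) (n : nat) :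
  a 0%nat = 1 -> (forall k, a (S k) = 0) -> PS_mult a b n = b n.
Proof.
intros H0 HS. destruct n as [|n].
- unfold PS_mult; simpl. rewrite H0. ring.
- rewrite PS_mult_succ, H0. unfold PS_mult. rewrite sum_eq_R0; [ring|].
  intros k _. rewrite HS. ring.
Qed.

Lemma PS_mult_one_r (a : nat -> R) (n : nat) :
  PS_mult a (fun _ => 1) n = sum_f_R0 a n.
Proof.
apply sum_eq. intros k _. ring.
Qed.

(** The series [t a'(t)] has no constant term; dividing it by [t] leaves [a'(t)]. *)
Lemma PS_mult_euler_l (a b : nat -> R) (n : nat) :
  PS_mult (fun k => INR k * a k) b (S n) =
  PS_mult (fun k => INR (S k) * a (S k)) b n.
Proof.
rewrite PS_mult_succ. simpl INR at 1. ring.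
Qed.

(* The Leibniz rule for the operator [t d/dt]. *)
Lemma PS_mult_leibniz (a b : nat -> R) (n : nat) :
  INR n * PS_mult a b n =
  PS_mult (fun k => INR k * a k) b n + PS_mult a (fun k => INR k * b k) n.
Proof.
unfold PS_mult. rewrite scal_sum, <- plus_sum. apply sum_eq. intros k Hk.
rewrite minus_INR by easy. ring.
Qed.

(** The equation [(1 + lambda t) f' = x f] for [f = deg_exp lambda x], read on coefficients. *)
Lemma deg_ffact_fact_succ (lambda x : R) (k : nat) :
  INR (S k) * (deg_ffact lambda x (S k) / INR (fact (S k))) =
  - lambda * (INR k * (deg_ffact lambda x k / INR (fact k)))
  + x * (deg_ffact lambda x k / INR (fact k)).
Proof.
pose proof (INR_fact_neq_0 k). assert (INR (S k) <> 0) by now apply not_0_INR.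
simpl deg_ffact. rewrite fact_simpl, mult_INR. field. easy.
Qed.

(* Both sides solve [(1 + lambda t) f' = (x + y) f] with [f 0 = 1]. *)
Lemma deg_ffact_vandermonde (lambda x y : R) (n : nat) :
  PS_mult (fun k => deg_ffact lambda x k / INR (fact k))
          (fun k => deg_ffact lambda y k / INR (fact k)) n =
  deg_ffact lambda (x + y) n / INR (fact n).
Proof.
set (P := fun z k => deg_ffact lambda z k / INR (fact k)).
(* The differential equation of the factor [P u], multiplied by [P v]. Since [u] and [v] are
   arbitrary, it serves each factor in turn. *)
assert (Hrec : forall u v m,
  PS_mult (fun k => INR k * P u k) (P v) (S m) =
  - lambda * PS_mult (fun k => INR k * P u k) (P v) m + u * PS_mult (P u) (P v) m).
{ intros u v m. rewrite PS_mult_euler_l.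
  rewrite (PS_mult_ext _ (fun k => - lambda * (INR k * P u k) + u * P u k) (P v) (P v))
    by (reflexivity || intro; apply deg_ffact_fact_succ).
  rewrite (PS_mult_linear_l _ (fun k => INR k * P u k)). f_equal.
  unfold PS_mult. rewrite scal_sum. apply sum_eq. intros k _. ring. }
change (PS_mult (P x) (P y) n = P (x + y) n).
induction n as [|n IH]; [unfold PS_mult, P; simpl; field|].
apply Rmult_eq_reg_l with (INR (S n)); [|now apply not_0_INR].
unfold P at 3. rewrite deg_ffact_fact_succ. fold (P (x + y) n). rewrite <- IH.
(* The Leibniz rule is applied at index [n] as well as at [S n], so that the two instances of [Hrec]
   add up to the goal. *)
replace (- lambda * (INR n * PS_mult (P x) (P y) n)) with
  (- lambda * (PS_mult (fun k => INR k * P x k) (P y) n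
               + PS_mult (fun k => INR k * P y k) (P x) n))
  by (rewrite PS_mult_leibniz, (PS_mult_comm (P x)); reflexivity).
rewrite PS_mult_leibniz, (PS_mult_comm (P x) (fun k => INR k * P y k)), !Hrec.
rewrite (PS_mult_comm (P y) (P x)). ring.
Qed.

Lemma deg_ffact_zero_succ (lambda : R) (n : nat) : deg_ffact lambda 0 (S n) = 0.
Proof.
induction n as [|n IH]; [simpl; ring|].
change (deg_ffact lambda 0 (S n) * (0 - INR (S n) * lambda) = 0).
rewrite IH. ring.
Qed.

(** Convergence at the single point [e / 2] makes the terms there tend to 0, which cannot happen
    outside the disc of convergence. *)
Lemma CV_radius_pos_of_locally (a : nat -> R) (f : R -> R) :
  locally 0 (fun t : R => is_pseries a t (f t)) -> Rbar_lt 0 (CV_radius a).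
Proof.
intros [e He]. pose proof (cond_pos e) as He0.
assert (Hb : ball 0 e (e / 2)).
{ change (Rabs (e / 2 - 0) < e). rewrite Rabs_pos_eq; lra. }
apply Rbar_lt_le_trans with (Finite (Rabs (e / 2))).
- simpl. rewrite Rabs_pos_eq; lra.
- apply Rbar_not_lt_le. intro Hlt. apply (CV_disk_outside _ _ Hlt).
  apply (ex_series_lim_0 (fun k => a k * (e / 2) ^ k)). eexists.
  apply is_pseries_R. exact (He _ Hb).
Qed.

Lemma is_pseries_locally_unique (a b : nat -> R) (f : R -> R) :
  locally 0 (fun t : R => is_pseries a t (f t)) ->
  locally 0 (fun t : R => is_pseries b t (f t)) ->
  forall n, a n = b n.
Proof.
intros Ha Hb n.
apply PSeries_ext_recip; [now apply CV_radius_pos_of_locally with f..|].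
generalize (filter_and _ _ Ha Hb). apply filter_imp. intros t [Hat Hbt].
now rewrite (is_pseries_unique _ _ _ Hat), (is_pseries_unique _ _ _ Hbt).
Qed.

Lemma locally_is_pseries_PSeries (a : nat -> R) :
  Rbar_lt 0 (CV_radius a) ->
  locally 0 (fun t : R => is_pseries a t (PSeries a t)).
Proof.
intro H.
assert (Hr : exists r : posreal, Rbar_le r (CV_radius a)).
{ destruct (CV_radius a) as [r| |]; simpl in H; try easy.
  - exists (mkposreal r H). apply Rle_refl.
  - now exists (mkposreal 1 Rlt_0_1). }
destruct Hr as [r Hr]. exists r. intros t Ht.
apply PSeries_correct, CV_radius_inside.
apply Rbar_lt_le_trans with (2 := Hr).
change (Rabs (t - 0) < r) in Ht. now rewrite Rminus_0_r in Ht.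
Qed.

Lemma deg_derangement_sum (lambda : R) (d : nat -> R) :
  is_deg_derangement lambda d ->
  forall n, d n / INR (fact n) =
    sum_f_R0 (fun k => deg_ffact lambda (-1) k / INR (fact k)) n.
Proof.
intro Hd.
set (D := fun n => d n / INR (fact n)).
set (A := fun k => deg_ffact lambda (-1) k / INR (fact k)).
(* Multiplying the generating function by [1 - t] gives [D n - D (n - 1) = A n], with [D (-1)] read
   as 0. *)
assert (HDA : forall n, PS_minus D (PS_incr_1 D) n = A n).
{ apply is_pseries_locally_unique with (deg_exp lambda (-1)).
  2: apply locally_is_pseries_PSeries, CV_radius_deg_exp.
  (* This keeps [1 - t] nonzero, so that it cancels. *)
  assert (H1 : locally 0 (fun t : R => t < 1)) by (apply open_lt; lra).
  generalize (filter_and _ _ Hd H1). apply filter_imp. intros t [Ht Hlt].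
  replace (deg_exp lambda (-1) t) with
    (minus (/ (1 - t) * deg_exp lambda (-1) t)
           (scal t (/ (1 - t) * deg_exp lambda (-1) t))).
  - apply (is_pseries_minus (K := R_AbsRing) (V := R_NormedModule)).
    + exact Ht.
    + apply (is_pseries_incr_1 (K := R_AbsRing) (V := R_NormedModule)).
      exact Ht.
  - unfold minus, plus, opp, scal; simpl. unfold mult; simpl. field. lra. }
intro n. change (D n = sum_f_R0 A n).
induction n as [|n IH].
- generalize (HDA 0%nat). unfold PS_minus, plus, opp, zero; simpl.
  unfold zero; simpl. lra.
- generalize (HDA (S n)). unfold PS_minus, plus, opp; simpl. lra.
Qed.

Lemma sum_n_m_1_sum_f_R0 (f : nat -> R) (n : nat) :
  f 0%nat = 0 -> sum_n_m f 1 n = sum_f_R0 f n.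
Proof.
intro H. rewrite <- sum_n_Reals. unfold sum_n.
rewrite (sum_Sn_m f 0) by lia. rewrite H. symmetry. apply Rplus_0_l.
Qed.

(** Only [b] is normalised by factorials, so a factor [k!] stays with [a k]. The inner and outer
    sums of the theorem both have this mixed form. *)
Lemma PS_mult_fact (a b : nat -> R) (n : nat) :
  INR (fact n) * PS_mult a (fun k => b k / INR (fact k)) n =
  sum_f_R0 (fun k => INR (fact k) * Binomial.C n k * a k * b (n - k)%nat) n.
Proof.
unfold PS_mult, Binomial.C. rewrite scal_sum. apply sum_eq. intros k _.
field. split; apply INR_fact_neq_0.
Qed.

Theorem theorem2p12 (lambda : R) (hlambda : lambda <> 0)
    (d : nat -> R) (hd : is_deg_derangement lambda d)
    (n : nat) (hn : (1 <= n)%nat) :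
  deg_harmonic lambda n =
    / INR (fact n) *
      sum_n_m (fun j : nat =>
        Binomial.C n j * d (n - j)%nat *
        sum_n_m (fun k : nat =>
          INR (fact k) * Binomial.C j k *
          (deg_harmonic lambda k - deg_harmonic lambda (k - 1)%nat) *
          deg_ffact lambda 1 (j - k)%nat) 1 j) 1 n.
Proof.
(* [h 0 = 0] because [0 - 1 = 0] in [nat]. *)
set (h := fun k => deg_harmonic lambda k - deg_harmonic lambda (k - 1)%nat).
set (E := fun k => deg_ffact lambda 1 k / INR (fact k)).
set (A := fun k => deg_ffact lambda (-1) k / INR (fact k)).
set (D := fun k => d k / INR (fact k)).
assert (h0 : h 0%nat = 0) by apply Rminus_diag.
assert (Hinner : forall j,
  sum_n_m (fun k : nat => INR (fact k) * Binomial.C j k *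
    (deg_harmonic lambda k - deg_harmonic lambda (k - 1)%nat) *
    deg_ffact lambda 1 (j - k)%nat) 1 j = INR (fact j) * PS_mult h E j).
{ intro j. unfold E. rewrite PS_mult_fact. apply sum_n_m_1_sum_f_R0.
  fold (h 0%nat). rewrite h0. ring. }
(* The factor [fact j] produced by the inner sum is the one that [PS_mult_fact] requires; the term
   [j = 0] vanishes because [h 0 = 0]. *)
assert (Houter : sum_n_m (fun j : nat => Binomial.C n j * d (n - j)%nat *
    (INR (fact j) * PS_mult h E j)) 1 n =
  INR (fact n) * PS_mult (PS_mult h E) D n).
{ unfold D. rewrite PS_mult_fact, sum_n_m_1_sum_f_R0.
  - apply sum_eq. intros j _. ring.
  - unfold PS_mult; simpl. rewrite h0. ring. }
(* [D] is [A / (1 - t)] and [E * A = 1], so [E * D] is the geometric series. *)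
assert (HED : forall k, PS_mult E D k = 1).
{ intro k.
  rewrite (PS_mult_ext E E D (PS_mult A (fun _ => 1))).
  2: reflexivity.
  2: { intro i. rewrite PS_mult_one_r. now apply deg_derangement_sum. }
  rewrite <- PS_mult_assoc. apply (PS_mult_delta_l _ (fun _ => 1)).
  - unfold PS_mult, E, A; simpl. field.
  - intro i. unfold E, A. rewrite deg_ffact_vandermonde.
    replace (1 + -1) with 0 by ring. rewrite deg_ffact_zero_succ.
    apply Rdiv_0_l. }
rewrite (sum_n_m_ext _ (fun j : nat => Binomial.C n j * d (n - j)%nat *
    (INR (fact j) * PS_mult h E j))) by (intro j; now rewrite Hinner).
rewrite Houter, <- Rmult_assoc, Rinv_l, Rmult_1_l by apply INR_fact_neq_0.
rewrite PS_mult_assoc, (PS_mult_ext h h _ (fun _ => 1)), PS_mult_one_r by easy.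
(* The telescoping starts at [n = 0], where the harmonic sum is empty and [h 0 = 0]. *)
clear. induction n as [|n IH].
- simpl. unfold h. rewrite Rminus_diag. apply (sum_n_m_zero (G := R_AbelianMonoid)). lia.
- simpl. rewrite <- IH. unfold h. replace (S n - 1)%nat with n by lia. ring.
Qed.
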